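(* Let $R$ be a fractionnally self fp-injective ring. If $R$ is a Bézout ring, then $R$ is a Kaplansky ring.
   Context: All rings are commutative with identity. For a ring $S$, $Q(S)$ denotes its classical ring of quotients. A ring $S$ is self fp-injective if $\mathrm{Ext}^1_S(F,S)=0$ for every finitely presented $S$-module $F$. $R$ is fractionnally self fp-injective if $Q(R/A)$ is self fp-injective for every proper ideal $A$ of $R$. $R$ is Bézout if every finitely generated ideal is principal. $R$ is a Kaplansky ring (elementary divisor ring) if for every matrix $A$ over $R$ there exist invertible matrices $P,Q$ and a diagonal matrix $D$ over $R$ such that $PAQ=D$. *)

(* Defs.v *)
From HB Require Import structures.
From mathcomp Require Import all_boot all_order all_algebra.
Set Implicit Arguments. Unset Strict Implicit. Unset Printing Implicit Defensive.
Import Order.TTheory GRing.Theory.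
Local Open Scope ring_scope.

Definition proper_ideal (R : comPzRingType) (A : R -> Prop) : Prop :=
  [/\ A 0, (forall x y, A x -> A y -> A (x + y)),
      (forall r x, A x -> A (r * x)) & ~ A 1].

Definition is_quotient_by (R : comPzRingType) (S : comNzRingType) (A : R -> Prop)
  (pi : {rmorphism R -> S}) : Prop :=
  (forall y : S, exists x : R, pi x = y) /\ (forall x : R, pi x = 0 <-> A x).

Definition regular (S : comNzRingType) (s : S) : Prop :=
  forall x : S, s * x = 0 -> x = 0.

Definition is_classical_quotient (S T : comNzRingType)
  (f : {rmorphism S -> T}) : Prop :=
  [/\ injective f,
      (forall s : S, regular s -> exists u : T, f s * u = 1) &
      (forall t : T, exists a s : S, regular s /\ t * f s = f a)].

(* Self fp-injectivity (Ext^1_S(F,S) = 0 for all finitely presented F),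
   in its standard equivalent form: every S-linear map from a finitely
   generated submodule of S^n (spanned by the rows of V) to S extends to S^n.
   A map on the row span sending row i to b_i is well defined iff every
   relation among the rows is respected by b. *)
Definition self_fp_injective (S : comNzRingType) : Prop :=
  forall (m n : nat) (V : 'M[S]_(m, n)) (b : 'cV[S]_m),
    (forall c : 'rV[S]_m, c *m V = 0 -> c *m b = 0) ->
    exists x : 'cV[S]_n, V *m x = b.

Definition fractionally_self_fp_injective (R : comPzRingType) : Prop :=
  forall A : R -> Prop, proper_ideal A ->
    exists (S : comNzRingType) (pi : {rmorphism R -> S})
           (T : comNzRingType) (f : {rmorphism S -> T}),
      [/\ is_quotient_by A pi, is_classical_quotient f & self_fp_injective T].

Definition bezout_ring (R : comPzRingType) : Prop :=
  forall (n : nat) (a : 'I_n -> R), exists d : R,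
    forall x : R, (exists c : 'I_n -> R, x = \sum_(i < n) c i * a i)
                  <-> (exists y : R, x = d * y).

Definition invertible_mx (R : comPzRingType) (k : nat) (P : 'M[R]_k) : Prop :=
  exists P' : 'M[R]_k, P *m P' = 1%:M /\ P' *m P = 1%:M.

Definition diagonal_mx (R : comPzRingType) (m n : nat) (D : 'M[R]_(m, n)) : Prop :=
  forall (i : 'I_m) (j : 'I_n), (i : nat) != (j : nat) -> D i j = 0.

Definition kaplansky_ring (R : comPzRingType) : Prop :=
  forall (m n : nat) (M : 'M[R]_(m, n)),
    exists (P : 'M[R]_m) (Q : 'M[R]_n) (D : 'M[R]_(m, n)),
      [/\ invertible_mx P, invertible_mx Q, diagonal_mx D & P *m M *m Q = D].

(* Main.v *)
(* Modulo the radical of a principal ideal, the total quotient ring of [R] is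
   reduced and self fp-injective, hence von Neumann regular; by the Bezout
   property every element [d] of such a quotient of [R] then has the same
   annihilator as an idempotent.  Splitting along these idempotents gives the
   Hermite property modulo nilpotents, which lifts to [R] through stable range 2,
   and, modulo the radical of [a * c], solves Kaplansky's condition: if [a], [b],
   [c] generate [R], so do [p * a], [p * b + q * c] for some [p], [q].  Hence a
   matrix whose entries generate the unit ideal has [u *m M *m v = 1] for some
   [u], [v]; completing [u] and [v] to invertible matrices splits off a corner. *)
Require Import Defs.
From HB Require Import structures.
From mathcomp Require Import all_boot all_order all_algebra.
From mathcomp Require Import ring.
From Stdlib Require Import Classical.
Set Implicit Arguments. Unset Strict Implicit. Unset Printing Implicit Defensive.
Import GRing.Theory.
Local Open Scope ring_scope.

(** * Radicals of principal ideals *)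

Definition radical (R : comPzRingType) (c : R) : R -> Prop :=
  fun x => exists (k : nat) (y : R), x ^+ k = c * y.

(** Each term of the binomial expansion of [(x + y) ^+ (k + l)] contains [x ^+ k] or [y ^+ l]. *)
Lemma radicalD (R : comPzRingType) (c x y : R) :
  radical c x -> radical c y -> radical c (x + y).
Proof.
move=> [k [u xk]] [l [v yl]]; exists (k + l)%N.
rewrite exprDn.
apply: (big_ind (fun s => exists w, s = c * w)).
- by exists 0; rewrite mulr0.
- by move=> _ _ [w ->] [w' ->]; exists (w + w'); rewrite mulrDr.
move=> i _; have [il|li] := leqP l i.
  exists ((x ^+ (k + l - i) * (v * y ^+ (i - l))) *+ 'C(k + l, i)).
  have -> : y ^+ i = c * v * y ^+ (i - l) by rewrite -yl -exprD subnKC.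
  by rewrite mulrnAr; congr (_ *+ _); ring.
have ki : (k <= k + l - i)%N by rewrite -addnBA ?leq_addr // ltnW.
exists ((u * x ^+ (k + l - i - k) * y ^+ i) *+ 'C(k + l, i)).
have -> : x ^+ (k + l - i) = c * u * x ^+ (k + l - i - k).
  by rewrite -xk -exprD subnKC.
by rewrite mulrnAr; congr (_ *+ _); ring.
Qed.

Lemma radicalMl (R : comPzRingType) (c r x : R) :
  radical c x -> radical c (r * x).
Proof. by move=> [k [y xk]]; exists k, (r ^+ k * y); rewrite exprMn xk; ring. Qed.

Lemma radical0 (R : comPzRingType) (c : R) : radical c 0.
Proof. by exists 1%N, 0; rewrite expr1 mulr0. Qed.

Lemma radicalX (R : comPzRingType) (c x : R) (n : nat) :
  radical c (x ^+ n) -> radical c x.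
Proof. by move=> [k [y xk]]; exists (n * k)%N, y; rewrite exprM. Qed.

(** * Idempotent supports modulo a radical *)

Lemma bezout_pair (R : comPzRingType) (a b : R) : bezout_ring R ->
  exists d a' b' u v, [/\ a = d * a', b = d * b' & d = u * a + v * b].
Proof.
move=> /(_ 2%N (fun i => if i == 0 then a else b)) [d dP].
have [a' aE] : exists y, a = d * y.
  apply/dP; exists (fun i => if i == 0 then 1 else 0).
  by rewrite !big_ord_recl big_ord0 /=; ring.
have [b' bE] : exists y, b = d * y.
  apply/dP; exists (fun i => if i == 0 then 0 else 1).
  by rewrite !big_ord_recl big_ord0 /=; ring.
have [c dE] : exists c : 'I_2 -> R, d = \sum_(i < 2) c i * (if i == 0 then a else b).
  by apply/dP; exists 1; rewrite mulr1.
exists d, a', b', (c 0), (c (lift 0 0)); split => //.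
by rewrite {1}dE !big_ord_recl big_ord0 /= addr0.
Qed.

(** Sending [t ^+ 2] to [t] is a well-defined map on the ideal of [t ^+ 2]: if [c * t ^+ 2 = 0],
    then [c * t] squares to zero. Its extension to [T] is multiplication by [x]. *)
Lemma reduced_fp_injective_regular (T : comNzRingType) :
  (forall t : T, t ^+ 2 = 0 -> t = 0) -> self_fp_injective T ->
  forall t : T, exists x, t ^+ 2 * x = t.
Proof.
move=> redT injT t.
have [|x] := injT 1%N 1%N (t ^+ 2)%:M t%:M.
  move=> c; rewrite (mx11_scalar c) -!scalar_mxM => /matrixP /(_ 0 0).
  rewrite !mxE eqxx !mulr1n => h.
  suff -> : c 0 0 * t = 0 by rewrite raddf0.
  by apply: redT; rewrite exprMn expr2 -mulrA h mulr0.
rewrite (mx11_scalar x) -scalar_mxM => /matrixP /(_ 0 0).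
by rewrite !mxE eqxx !mulr1n => h; exists (x 0 0).
Qed.

(* The ring [R / radical c] has a total quotient ring that is von Neumann
   regular; [a / s] is there the idempotent generating the same ideal as [d]. *)
Lemma radical_support_fraction (R : comPzRingType) (c d : R) :
  fractionally_self_fp_injective R ->
  exists a s, [/\ forall x, radical c (s * x) -> radical c x,
    radical c (a * (s - a)), radical c (d * (s - a)) &
    forall x, radical c (x * d) -> radical c (x * a)].
Proof.
move=> fracR; have [c1|c1] := classic (radical c 1).
  have allc x : radical c x by rewrite -[x]mulr1; apply: radicalMl.
  by exists 0, 0; split=> *; apply: allc.
have [|S [pi [T [f [[pi_surj piP] [f_inj f_unit f_frac] injT]]]]] := fracR (radical c).
  by split; [exact: radical0 | exact: radicalD | exact: radicalMl | exact: c1].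
have redS (x : S) : x ^+ 2 = 0 -> x = 0.
  have [r <-] := pi_surj x; rewrite -rmorphXn => /piP h.
  by apply/piP; exact: radicalX h.
have redT (t : T) : t ^+ 2 = 0 -> t = 0.
  move=> t2; have [a [s [s_reg tsE]]] := f_frac t.
  have a0 : a = 0.
    apply: redS; apply: f_inj; rewrite rmorphXn rmorph0 -tsE exprMn t2.
    by rewrite mul0r.
  have [u su] := f_unit _ s_reg.
  by rewrite -[t]mulr1 -su mulrA tsE a0 rmorph0 mul0r.
have [x txE] := reduced_fp_injective_regular redT injT (f (pi d)).
have [a [s [s_reg asE]]] := f_frac (f (pi d) * x).
have [a0 aE] := pi_surj a; have [s0 sE] := pi_surj s.
have inE r : f (pi r) = 0 -> radical c r.
  by move=> fr; apply/piP; apply: f_inj; rewrite fr rmorph0.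
have inP r : radical c r -> f (pi r) = 0 by move=> /piP->; rewrite rmorph0.
exists a0, s0; split.
- move=> r /piP; rewrite rmorphM sE => /s_reg rr; exact/piP.
- apply: inE; rewrite !(rmorphM, rmorphB) aE sE -asE.
  set t := f (pi d) in txE *; set y := f s.
  transitivity (y ^+ 2 * x * (t - t ^+ 2 * x)); first ring.
  by rewrite txE subrr mulr0.
- apply: inE; rewrite !(rmorphM, rmorphB) aE sE -asE.
  set t := f (pi d) in txE *; set y := f s.
  transitivity (y * (t - t ^+ 2 * x)); first ring.
  by rewrite txE subrr mulr0.
move=> r /inP; rewrite !rmorphM => h; apply: inE.
by rewrite !rmorphM aE -asE !mulrA h !mul0r.
Qed.

(** Removes the denominator of the idempotent [a / s]. The gcd [g] of [a] and [s - a] divides [s],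
    so it cancels modulo the radical; hence the cofactors [t], [t'] are comaximal with product zero
    there, and [u * t] is idempotent. *)
Lemma radical_support (R : comPzRingType) (c d : R) :
  fractionally_self_fp_injective R -> bezout_ring R ->
  exists e, [/\ radical c (e * (1 - e)), radical c (d * (1 - e)) &
    forall x, radical c (x * d) -> radical c (x * e)].
Proof.
move=> fracR bezR.
have [a [s [s_reg a_idem da aP]]] := radical_support_fraction c d fracR.
have [g [t [t' [u [v [aE saE gE]]]]]] := bezout_pair a (s - a) bezR.
have g_reg x : radical c (g * x) -> radical c x.
  move=> gx; apply: s_reg.
  have -> : s * x = (t + t') * (g * x).
    by rewrite -[s](subrK a) saE aE; ring.
  exact: radicalMl.
have r1 : radical c (1 - u * t - v * t').
  apply: g_reg.
  have -> : g * (1 - u * t - v * t') = g - (u * (g * t) + v * (g * t')) by ring.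
  by rewrite -aE -saE -gE subrr; exact: radical0.
have r2 : radical c (t * t').
  apply: (g_reg); apply: (g_reg).
  by have -> : g * (g * (t * t')) = a * (s - a) by rewrite saE aE; ring.
have r3 : radical c (d * t').
  by apply: g_reg; have -> : g * (d * t') = d * (s - a) by rewrite saE; ring.
exists (u * t); split.
- have -> : u * t * (1 - u * t) =
    u * t * (1 - u * t - v * t') + u * v * (t * t') by ring.
  by apply: radicalD; apply: radicalMl.
- have -> : d * (1 - u * t) = d * (1 - u * t - v * t') + v * (d * t') by ring.
  by apply: radicalD; apply: radicalMl.
move=> x /aP xa.
have -> : x * (u * t) = u * (x * t) by ring.
apply: radicalMl; apply: g_reg.
by have -> : g * (x * t) = x * a by rewrite aE; ring.
Qed.

(** * The Hermite property and Kaplansky's triple condition *)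

Lemma nil_hermite (R : comPzRingType) (a b : R) :
  fractionally_self_fp_injective R -> bezout_ring R ->
  exists d a' b' x y, [/\ radical 0 (a - d * a'), radical 0 (b - d * b') &
    radical 0 (1 - x * a' - y * b')].
Proof.
move=> fracR bezR.
have [d [a' [b' [u [v [aE bE dE]]]]]] := bezout_pair a b bezR.
have [e [e_idem de eP]] := radical_support 0 d fracR bezR.
have we : radical 0 ((1 - u * a' - v * b') * e).
  apply: eP.
  have -> : (1 - u * a' - v * b') * d = d - (u * (d * a') + v * (d * b')) by ring.
  by rewrite -aE -bE -dE subrr; exact: radical0.
(* Modulo nilpotents, [u * a' + v * b' = 1] holds on the part [e], while [d] vanishes on [1 - e], so
   the cofactors can be replaced by [(1, 0)] there. *)
exists d, (a' * e + (1 - e)), (b' * e), (u * e + (1 - e)), (v * e); split.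
- have -> : a - d * (a' * e + (1 - e)) = (a' - 1) * (d * (1 - e)).
    by rewrite aE; ring.
  exact: radicalMl.
- have -> : b - d * (b' * e) = b' * (d * (1 - e)) by rewrite bE; ring.
  exact: radicalMl.
have -> : 1 - (u * e + (1 - e)) * (a' * e + (1 - e)) - v * e * (b' * e) =
  e * ((1 - u * a' - v * b') * e) + (2%:R - u - a') * (e * (1 - e)) by ring.
by apply: radicalD; apply: radicalMl.
Qed.

(** Geometric sum; for [c = 0] it inverts [1 - n] with [n] nilpotent. *)
Lemma radical_invertible (R : comPzRingType) (c n : R) : radical c n ->
  exists k y, k * (1 - n) = 1 - c * y.
Proof.
move=> [k [y nk]]; exists (\sum_(i < k) n ^+ i), y.
by rewrite -nk -[LHS]opprK -mulrN opprB mulrC -subrX1 opprB.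
Qed.

(** Modulo nilpotents, [(a', b')] and [(q, - p)] form a basis of the plane in which
    [(a + q * c, b - p * c)] has coordinates [(d, c)], and these generate the unit ideal because
    [l * d + z * c = 1]. *)
Lemma stable_range2 (R : comPzRingType) (a b c x y z : R) :
  fractionally_self_fp_injective R -> bezout_ring R ->
  x * a + y * b + z * c = 1 ->
  exists r s x' y', x' * (a + r * c) + y' * (b + s * c) = 1.
Proof.
move=> fracR bezR xyz.
have [d [a' [b' [p [q [na nb n1]]]]]] := nil_hermite a b fracR bezR.
pose l := x * a' + y * b'.
have n2 : radical 0 (1 - ((l * p + z * b') * (a + q * c)
                         + (l * q - z * a') * (b - p * c))).
  rewrite -{1}xyz.
  set n := (X in radical _ X).
  have -> : n = (x - l * p - z * b') * (a - d * a')
     + (y - l * q + z * a') * (b - d * b')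
     + (l * d + z * c) * (1 - p * a' - q * b') by rewrite /n /l; ring.
  by do ?apply: radicalD; apply: radicalMl.
have [k [y0 kE]] := radical_invertible n2.
exists q, (- p), (k * (l * p + z * b')), (k * (l * q - z * a')).
rewrite mulNr -!mulrA -mulrDr.
by move: kE; rewrite subKr mul0r subr0.
Qed.

Definition hermite_ring (R : comPzRingType) : Prop :=
  forall a b : R, exists d a' b' x y,
    [/\ a = d * a', b = d * b' & x * a' + y * b' = 1].

(** The defect [w] is killed by [d], so adding multiples of it to the cofactors is harmless; stable
    range chooses multiples that make them comaximal. *)
Lemma fractional_bezout_hermite (R : comPzRingType) :
  fractionally_self_fp_injective R -> bezout_ring R -> hermite_ring R.
Proof.
move=> fracR bezR a b.
have [d [a' [b' [u [v [aE bE dE]]]]]] := bezout_pair a b bezR.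
pose w := 1 - u * a' - v * b'.
have dw : d * w = 0.
  have -> : d * w = d - (u * (d * a') + v * (d * b')) by rewrite /w; ring.
  by rewrite -aE -bE -dE subrr.
have [|r [s [x [y xy]]]] := stable_range2 (a := a') (b := b') (c := w)
    (x := u) (y := v) (z := 1) fracR bezR.
  by rewrite /w; ring.
exists d, (a' + r * w), (b' + s * w), x, y; split => //.
  by rewrite mulrDr mulrCA dw mulr0 addr0.
by rewrite mulrDr mulrCA dw mulr0 addr0.
Qed.

(** The row [(p, q)] times the triangular matrix with rows [(a, b)] and [(0, c)] is unimodular. *)
Definition unimodular_triple_property (R : comPzRingType) : Prop :=
  forall a b c x y z : R, x * a + y * b + z * c = 1 ->
    exists p q x' y', x' * (p * a) + y' * (p * b + q * c) = 1.

(* Modulo [radical (a * c)] an idempotent [e] splits the ring into a part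
   where [c = 0], on which [(p, q) = (1, 0)] works, and a part where [a = 0],
   on which [(p, q) = (y, z)] works. *)
Lemma fractional_bezout_triple (R : comPzRingType) :
  fractionally_self_fp_injective R -> bezout_ring R -> unimodular_triple_property R.
Proof.
move=> fracR bezR a b c x y z xyz.
have [e [e_idem ae eP]] := radical_support (a * c) a fracR bezR.
have ce : radical (a * c) (c * e) by apply: eP; exists 1%N, 1; ring.
pose p := e + (1 - e) * y; pose q := (1 - e) * z.
have n1 : radical (a * c)
    (1 - (x * (p * a) + (y * e + 1 - e) * (p * b + q * c))).
  set n := (X in radical _ X).
  have -> : n = (y * b + 1 - x * a - b - y * (1 - x * a)) * (e * (1 - e))
     + (x - x * y) * (a * (1 - e)) + z * (c * e)
     + ((y * e + 1 - e) * (1 - e) + e) * (1 - (x * a + y * b + z * c)).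
    by rewrite /n /p /q; ring.
  rewrite xyz subrr mulr0 addr0.
  by do ?apply: radicalD; apply: radicalMl.
(* Once [p0], [q0] are comaximal, Cramer's rule puts the determinant [a * c] in the ideal of
   [p0 * a] and [p0 * b + q0 * c], which absorbs the error [a * c * w]. *)
have [h [p0 [q0 [s [t [pE qE st]]]]]] := fractional_bezout_hermite fracR bezR p q.
have [k [w kE]] := radical_invertible n1.
move: kE; rewrite subKr pE qE => kE.
exists p0, q0, (k * x * h + w * (s * c - t * b)), (k * (y * e + 1 - e) * h + w * (t * a)).
transitivity (k * (x * (h * p0 * a) +
      (y * e + 1 - e) * (h * p0 * b + h * q0 * c)) + a * c * w * (s * p0 + t * q0)).
  by ring.
by rewrite kE st; ring.
Qed.

(** * Invertible block matrices *)

Lemma invertible_mxM (R : comPzRingType) (k : nat) (P Q : 'M[R]_k) :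
  invertible_mx P -> invertible_mx Q -> invertible_mx (P *m Q).
Proof.
move=> [P' [PP' P'P]] [Q' [QQ' Q'Q]]; exists (Q' *m P'); split.
  by rewrite mulmxA -(mulmxA P) QQ' mulmx1.
by rewrite mulmxA -(mulmxA Q') P'P mulmx1.
Qed.

Lemma invertible_mx_tr (R : comPzRingType) (k : nat) (P : 'M[R]_k) :
  invertible_mx P -> invertible_mx P^T.
Proof.
move=> [P' [PP' P'P]]; exists P'^T.
by rewrite -!trmx_mul PP' P'P trmx1.
Qed.

Lemma invertible_diag_block (R : comPzRingType) (m n : nat) (P : 'M[R]_m) (Q : 'M[R]_n) :
  invertible_mx P -> invertible_mx Q -> invertible_mx (block_mx P 0 0 Q).
Proof.
move=> [P' [PP' P'P]] [Q' [QQ' Q'Q]]; exists (block_mx P' 0 0 Q').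
by rewrite !mulmx_block !(mulmx0, mul0mx, addr0, add0r) PP' P'P QQ' Q'Q
  -!scalar_mx_block.
Qed.

Lemma invertible_mx1 (R : comPzRingType) (k : nat) : invertible_mx (1%:M : 'M[R]_k).
Proof. by exists 1%:M; rewrite mulmx1. Qed.

Lemma invertible_lblock (R : comPzRingType) (m n : nat) (X : 'M[R]_(n, m)) :
  invertible_mx (block_mx 1%:M 0 X 1%:M).
Proof.
exists (block_mx 1%:M 0 (- X) 1%:M).
by rewrite !mulmx_block !(mulmx0, mul0mx, mulmx1, mul1mx, addr0, add0r) addrN addNr
  -!scalar_mx_block.
Qed.

Lemma invertible_ublock (R : comPzRingType) (m n : nat) (X : 'M[R]_(m, n)) :
  invertible_mx (block_mx 1%:M X 0 1%:M).
Proof.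
exists (block_mx 1%:M (- X) 0 1%:M).
by rewrite !mulmx_block !(mulmx0, mul0mx, mulmx1, mul1mx, addr0, add0r) addrN addNr
  -!scalar_mx_block.
Qed.

(** * Row reduction over a Hermite ring *)

Lemma hermite_row (R : comPzRingType) (n : nat) (u : 'rV[R]_(1 + n)) :
  hermite_ring R ->
  exists (Q : 'M[R]_(1 + n)) (d : R),
    invertible_mx Q /\ u *m Q = row_mx d%:M 0.
Proof.
move=> hermR; elim: n u => [|n IHn] u.
  exists 1%:M, (lsubmx u 0 0); split; first exact: invertible_mx1.
  by rewrite mulmx1 -mx11_scalar -[u in LHS]hsubmxK [rsubmx u]thinmx0.
rewrite -[u]hsubmxK; set a := lsubmx u.
have [Q [b [Qinv uQ]]] := IHn (rsubmx u).
have [d [a' [b' [x [y [aE bE xy]]]]]] := hermR (a 0 0) b.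
(* Its determinant is [x * a' + y * b' = 1], and it sends [(a, b)] to [(d, 0)]. *)
pose H2 : 'M[R]_(1 + 1) := block_mx x%:M (- b')%:M y%:M a'%:M.
have zero11 : 0 = 0%:M :> 'M[R]_1 by rewrite raddf0.
have H2inv : invertible_mx H2.
  exists (block_mx a'%:M b'%:M (- y)%:M x%:M).
  split; rewrite mulmx_block -!scalar_mxM -!raddfD /= (scalar_mx_block 1 1 1) zero11;
    by congr block_mx; congr _%:M; rewrite -?xy; ring.
pose H : 'M[R]_(1 + (1 + n)) := block_mx H2 0 0 1%:M.
have row3E (s t : 'rV[R]_1) :
    row_mx s (row_mx t 0) = row_mx (row_mx s t) 0 :> 'rV_(1 + (1 + n)).
  by rewrite row_mxA castmx_id.
exists (block_mx 1%:M 0 0 Q *m H), d; split.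
  apply: invertible_mxM.
    by apply: invertible_diag_block => //; exact: invertible_mx1.
  exact: (@invertible_diag_block R (1 + 1) n _ _ H2inv (invertible_mx1 R n)).
rewrite mulmxA mul_row_block !(mulmx0, mulmx1, add0r, addr0) uQ row3E.
rewrite -(row_mx0 _ 1 1 n) row3E.
rewrite [a]mx11_scalar.
apply: (etrans (@mul_row_block R 1 (1 + 1) n (1 + 1) n _ _ _ _ _ _)).
rewrite mul_row_block !(mulmx0, mul0mx, addr0).
rewrite -!scalar_mxM -!raddfD /= ?zero11.
have -> : a 0 0 * x + b * y = d by rewrite aE bE -[RHS]mulr1 -xy; ring.
by have -> : a 0 0 * - b' + b * a' = 0 by rewrite aE bE; ring.
Qed.

Lemma unimodular_row (R : comPzRingType) (n : nat) (u : 'rV[R]_(1 + n)) v :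
  hermite_ring R -> u *m v = 1%:M ->
  exists Q : 'M[R]_(1 + n), invertible_mx Q /\ u *m Q = row_mx 1%:M 0.
Proof.
move=> hermR uv1; have [Q [d [Qinv uQ]]] := hermite_row u hermR.
have [Q' [QQ' Q'Q]] := Qinv.
(* Unimodularity makes [d] a unit with inverse [e]; scaling the first column by [e] normalizes it to
   1. *)
pose e := usubmx (Q' *m v) 0 0.
have de : d * e = 1.
  have : u *m Q *m (Q' *m v) = 1%:M by rewrite mulmxA -(mulmxA u) QQ' mulmx1.
  rewrite uQ -[Q' *m v]vsubmxK mul_row_col mul0mx addr0.
  rewrite [usubmx _]mx11_scalar -/e -scalar_mxM => /matrixP /(_ 0 0).
  by rewrite !mxE eqxx.
exists (Q *m block_mx e%:M 0 0 1%:M); split.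
  apply: invertible_mxM => //; apply: invertible_diag_block; last exact: invertible_mx1.
  by exists d%:M; rewrite -!scalar_mxM [e * d]mulrC de.
by rewrite mulmxA uQ mul_row_block !(mulmx0, mul0mx, addr0) -scalar_mxM de.
Qed.

Lemma unimodular_column (R : comPzRingType) (n : nat) (v : 'cV[R]_(1 + n)) u :
  hermite_ring R -> u *m v = 1%:M ->
  exists P : 'M[R]_(1 + n), invertible_mx P /\ P *m v = col_mx 1%:M 0.
Proof.
move=> hermR uv1; have [|Q [Qinv vQ]] := @unimodular_row R n v^T u^T hermR.
  by rewrite -trmx_mul uv1 trmx1.
exists Q^T; split; first exact: invertible_mx_tr.
by apply: trmx_inj; rewrite trmx_mul trmxK vQ tr_col_mx trmx1 trmx0.
Qed.

(** The row [u'] is the first row of the inverse of [Q], and [v] is the first column of [Q]. *)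
Lemma hermite_row_factor (R : comPzRingType) (n : nat) (u : 'rV[R]_(1 + n)) :
  hermite_ring R ->
  exists d u' v, u = d *: u' /\ u' *m v = 1%:M.
Proof.
move=> hermR; have [Q [d [[Q' [QQ' Q'Q]] uQ]]] := hermite_row u hermR.
exists d, (row_mx 1%:M 0 *m Q'), (Q *m col_mx 1%:M 0); split.
  rewrite -[u]mulmx1 -QQ' mulmxA uQ scalemxAl; congr (_ *m _).
  by rewrite scale_row_mx scaler0 scale_scalar_mx mulr1.
by rewrite mulmxA -(mulmxA _ Q') Q'Q mulmx1 mul_row_col mul0mx addr0 mulmx1.
Qed.

(* [\tr (M' *m W) = 1] for some [W] says that the entries of [M'] generate
   the unit ideal. *)
Lemma hermite_mx_factor (R : comPzRingType) (m n : nat) (M : 'M[R]_(1 + m, 1 + n)) :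
  hermite_ring R ->
  exists d M' W, M = d *: M' /\ \tr (M' *m W) = 1.
Proof.
move=> hermR.
have [d [u [v [uE uv]]]] : exists d (u : 'rV_((1 + m) * (1 + n))) v,
    mxvec M = d *: u /\ u *m v = 1%:M.
  (* The length [(1 + m) * (1 + n)] is convertible to [1 + (n + m * (1 + n))]. *)
  exact: (@hermite_row_factor R (n + m * (1 + n)) (mxvec M) hermR).
exists d, (vec_mx u), (vec_mx v^T)^T; split.
  by apply: (can_inj mxvecK); rewrite linearZ /= vec_mxK.
have <- : (u *m v) 0 0 = 1 by rewrite uv mxE eqxx.
rewrite mxE (reindex _ (curry_mxvec_bij _ _)) /=.
transitivity (\sum_i \sum_j vec_mx u i j * vec_mx v^T i j).
  by apply: eq_bigr => i _; rewrite mxE; apply: eq_bigr => j _; rewrite [_^T _ _]mxE.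
by rewrite pair_bigA; apply: eq_bigr => -[i j] _; rewrite !mxE.
Qed.

(** * Reduction to diagonal form *)

Lemma gcd_row (R : comPzRingType) (n : nat) (u : 'rV[R]_n) :
  hermite_ring R -> exists d u' v, u = d *: u' /\ u *m v = d%:M.
Proof.
move=> hermR; case: n u => [|n] u.
  by exists 0, 0, 0; rewrite scaler0 mulmx0 raddf0 [u]thinmx0.
have [d [u' [v [uE uv]]]] := @hermite_row_factor R n u hermR.
by exists d, u', v; split=> //; rewrite {1}uE -scalemxAl uv scale_scalar_mx mulr1.
Qed.

(** Induction on rows: the rows below the first are [d *: M'] with [u' *m M' *m v' = 1]. In
    coordinates where [u' *m M'] is [(1, 0)] and the first row is [(r0, c *: r1')], the combination
    with coefficients [p], [q] is [(p * r0 + q * d, p * c *: r1')], so the triple property for [c],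
    [r0], [d] applies. *)
Lemma unimodular_mx (R : comPzRingType) (m n : nat)
    (M : 'M[R]_(1 + m, 1 + n)) (W : 'M[R]_(1 + n, 1 + m)) :
  hermite_ring R -> unimodular_triple_property R ->
  \tr (M *m W) = 1 -> exists (u : 'rV_(1 + m)) (v : 'cV_(1 + n)), u *m M *m v = 1%:M.
Proof.
move=> hermR tripR; elim: m M W => [|m IHm] M W trMW.
  exists 1%:M, W; rewrite mul1mx; move: (M *m W : 'M_1) trMW => A.
  by rewrite [A]mx11_scalar mxtrace_scalar mulr1n => ->.
move: trMW; rewrite -[M]vsubmxK -[W]hsubmxK.
move: (usubmx M) (dsubmx M) (lsubmx W) (rsubmx W) => r M2 w W2.
rewrite mul_col_row mxtrace_block => trMW.
have [d [M' [W' [M2E trM'W']]]] := @hermite_mx_factor R m n M2 hermR.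
have [u' [v' uMv]] := IHm M' W' trM'W'.
have [Q [[Q' [QQ' Q'Q]] sQ]] := unimodular_row hermR uMv.
pose r0 := lsubmx (r *m Q) 0 0; pose r1 := rsubmx (r *m Q).
have rQE : r *m Q = row_mx r0%:M r1 by rewrite -mx11_scalar hsubmxK.
have [c [r1' [v1 [r1E r1v1]]]] := gcd_row r1 hermR.
pose w' := Q' *m w; pose w0 := usubmx w' 0 0; pose w1 := (r1' *m dsubmx w') 0 0.
(* The trace condition, rewritten in the coordinates given by [Q]. *)
have triple : w1 * c + w0 * r0 + \tr (M' *m W2) * d = 1.
  rewrite -trMW M2E -scalemxAl linearZ /= [_ * d]mulrC; congr (_ + _).
  have -> : r *m w = r *m Q *m (Q' *m w) by rewrite mulmxA -(mulmxA r) QQ' mulmx1.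
  rewrite rQE -/w' -[w' in RHS]vsubmxK mul_row_col mxtraceD addrC.
  rewrite [usubmx w']mx11_scalar -/w0 -scalar_mxM mxtrace_scalar mulr1n mulrC.
  congr (_ + _); rewrite r1E -scalemxAl linearZ /= [r1' *m _]mx11_scalar -/w1.
  by rewrite mxtrace_scalar mulr1n mulrC.
have [p [q [x [y pq]]]] := tripR _ _ _ _ _ _ triple.
exists (row_mx p%:M (q *: u')), (Q *m col_mx y%:M (x *: v1)).
rewrite mul_row_col M2E -scalemxAl -scalemxAr !mulmxA mulmxDl mul_scalar_mx.
rewrite -!scalemxAl rQE sQ !scale_row_mx add_row_mx scaler0 scaler0 addr0.
rewrite mul_row_col -scalemxAr -scalemxAl r1v1 !scale_scalar_mx -raddfD /= -scalar_mxM.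
rewrite -raddfD /= mulr1 -pq; congr _%:M; ring.
Qed.

Lemma hermite_kaplansky (R : comPzRingType) :
  hermite_ring R -> unimodular_triple_property R -> kaplansky_ring R.
Proof.
move=> hermR tripR m; elim: m => [|m IHm] n M.
  by exists 1%:M, 1%:M, M; split; try exact: invertible_mx1;
    [case | rewrite mul1mx mulmx1].
case: n M => [|n] M.
  by exists 1%:M, 1%:M, M; split; try exact: invertible_mx1;
    [move=> i; case | rewrite mul1mx mulmx1].
have [d [M' [W [ME trM'W]]]] := @hermite_mx_factor R m n M hermR.
have [u [v uMv]] := unimodular_mx hermR tripR trM'W.
have [|U [[Ui [UUi UiU]] uU]] := @unimodular_row R m u (M' *m v) hermR.
  by rewrite mulmxA.
have [V [[Vi [VVi ViV]] Vv]] := @unimodular_column R n v (u *m M') hermR uMv.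
(* The first row of [Ui] is [u] and the first column of [Vi] is [v], so the corner of [N] is
   [u *m M' *m v]. *)
pose N : 'M_(1 + m, 1 + n) := Ui *m M' *m Vi.
have N1 : ulsubmx N = 1%:M.
  transitivity (row_mx 1%:M 0 *m N *m (col_mx 1%:M 0 : 'cV_(1 + n))).
    rewrite -[N in RHS]submxK mul_row_block mul_row_col.
    by rewrite !(mulmx0, mul0mx, mulmx1, mul1mx, addr0).
  by rewrite -uU -Vv !mulmxA -(mulmxA u) UUi mulmx1 -(mulmxA _ Vi) ViV mulmx1.
pose X := ursubmx N; pose Y := dlsubmx N; pose Z := drsubmx N.
have NE : N = block_mx 1%:M X Y Z by rewrite -N1 submxK.
(* Clearing [X] and [Y] against the corner 1 leaves the Schur complement [Z - Y *m X]. *)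
have [P [Q [D [Pinv Qinv diagD DE]]]] := IHm n (d *: (Z - Y *m X)).
pose P1 : 'M_(1 + m) := block_mx 1%:M 0 0 P *m (block_mx 1%:M 0 (- Y) 1%:M *m Ui).
pose Q1 : 'M_(1 + n) := Vi *m block_mx 1%:M (- X) 0 1%:M *m block_mx 1%:M 0 0 Q.
pose D1 : 'M_(1 + m, 1 + n) := block_mx d%:M 0 0 D.
have P1inv : invertible_mx P1.
  apply: invertible_mxM.
    by apply: invertible_diag_block => //; exact: invertible_mx1.
  by apply: invertible_mxM; [exact: invertible_lblock | exists U].
have Q1inv : invertible_mx Q1.
  apply: invertible_mxM.
    by apply: invertible_mxM; [exists V | exact: invertible_ublock].
  by apply: invertible_diag_block => //; exact: invertible_mx1.
have diagD1 : diagonal_mx D1.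
  move=> i j; case: (split_ordP i) => i' ->; case: (split_ordP j) => j' -> ij.
  - by move: ij; rewrite !ord1.
  - by rewrite block_mxEur mxE.
  - by rewrite block_mxEdl mxE.
  - by rewrite block_mxEdr; apply: diagD; apply: contra ij => /eqP /= ->.
have D1E : P1 *m M *m Q1 = D1.
  have -> : P1 *m M *m Q1 = d *: (block_mx 1%:M 0 0 P *m block_mx 1%:M 0 (- Y) 1%:M
      *m N *m block_mx 1%:M (- X) 0 1%:M *m block_mx 1%:M 0 0 Q).
    by rewrite ME -scalemxAr -scalemxAl /P1 /Q1 /N !mulmxA.
  rewrite NE !mulmx_block !(mulmx0, mul0mx, mulmx1, mul1mx, addr0, add0r).
  rewrite addNr mul0mx -mulmxDr addNr mulmx0 mul0mx add0r.
  rewrite -mulmxA -mulmxDr mulNmx [- _ + Z]addrC.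
  by rewrite scale_block_mx !scaler0 scale_scalar_mx mulr1 /D1 -DE -scalemxAr -scalemxAl.
by exists P1, Q1, D1.
Qed.

Theorem theorem3p5 (R : comPzRingType) :
  fractionally_self_fp_injective R -> bezout_ring R -> kaplansky_ring R.
Proof.
move=> fracR bezR; apply: hermite_kaplansky.
  exact: fractional_bezout_hermite.
exact: fractional_bezout_triple.
Qed.
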